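(* Let $\mathcal{G}_1$ be an $r_1$-regular graph of order $n_1$ with signless Laplacian eigenvalues $\nu_{11},\ldots,\nu_{1n_1}$, and let $\mathcal{G}_2$ be an arbitrary graph of order $n_2$ with signless Laplacian eigenvalues $\nu_{21},\ldots,\nu_{2n_2}$. Then the signless Laplacian characteristic polynomial of $\mathcal{G}_1\boxtimes\mathcal{G}_2$ is $$f(\mathcal{Q}_{\mathcal{G}_1\boxtimes\mathcal{G}_2},x)=\prod_{i=1}^{n_2}\big(x-(r_1+1)-\nu_{2i}\big)^{n_1}\cdot\prod_{i=1}^{n_1}\Big[x-n_2(r_1+1)-\nu_{1i}-\chi_{\mathcal{Q}_{\mathcal{G}_2}}\big(x-(r_1+1)\big)(1-r_1+\nu_{1i})^2\Big].$$
   Context: All graphs are finite, simple and undirected. For graphs $\mathcal{G}_1$ (vertices $u_1,\ldots,u_{n_1}$) and $\mathcal{G}_2$, the closed neighborhood corona $\mathcal{G}_1\boxtimes\mathcal{G}_2$ is obtained from $\mathcal{G}_1$ and $n_1$ disjoint copies of $\mathcal{G}_2$ by joining every vertex of the $i$-th copy to $u_i$ and to every neighbor of $u_i$ in $\mathcal{G}_1$, for each $i$. The signless Laplacian matrix is $\mathcal{Q}_{\mathcal{G}}=\mathcal{D}_{\mathcal{G}}+\mathcal{A}_{\mathcal{G}}$ (degree matrix plus adjacency matrix). For a square matrix $M$ of order $n$, $\chi_M(x)=\mathbf{1}_n^T(xI_n-M)^{-1}\mathbf{1}_n$ with $\mathbf{1}_n$ the all-ones vector, and $f(M,x)=\det(xI-M)$.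 *)

(* Defs.v *)
From HB Require Import structures.
From mathcomp Require Import all_boot all_order all_algebra.

Set Implicit Arguments.
Unset Strict Implicit.
Unset Printing Implicit Defensive.

Import GRing.Theory.
Local Open Scope ring_scope.

Record sgraph := SGraph {
  vertex : finType;
  edge : rel vertex;
  edge_sym : symmetric edge;
  edge_irr : irreflexive edge
}.

Definition degree (G : sgraph) (v : vertex G) : nat := #|[set w | edge v w]|.

Definition graph_order (G : sgraph) : nat := #|vertex G|.

Definition regular (G : sgraph) (r : nat) : Prop :=
  forall v : vertex G, degree v = r.

Section Corona.
Variables G1 G2 : sgraph.

(* [inl u] is the vertex u of G1; [inr (u, a)] is the vertex a of the copy of
   G2 attached to u. *)
Definition corona_vertex : finType := (vertex G1 + vertex G1 * vertex G2)%type.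

Definition corona_edge : rel corona_vertex := fun s t =>
  match s, t with
  | inl u, inl v => edge u v
  | inl u, inr (v, _) => (u == v) || edge v u
  | inr (u, _), inl v => (u == v) || edge u v
  | inr (u, a), inr (v, b) => (u == v) && edge a b
  end.

Lemma corona_edge_sym : symmetric corona_edge.
Proof.
move=> [u|[u a]] [v|[v b]] /=; last by rewrite eq_sym edge_sym.
- exact: edge_sym.
- by rewrite eq_sym.
- by rewrite eq_sym.
Qed.

Lemma corona_edge_irr : irreflexive corona_edge.
Proof. by move=> [u|[u a]] /=; rewrite edge_irr ?andbF. Qed.

Definition closed_nbhd_corona : sgraph :=
  SGraph corona_edge_sym corona_edge_irr.

End Corona.

(* Rows and columns are indexed through the enumeration of the vertex type. *)
Definition adjacency_mx (F : nzRingType) (G : sgraph) : 'M[F]_(graph_order G) :=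
  \matrix_(i, j) (@edge G (enum_val i) (enum_val j))%:R.

Definition degree_mx (F : nzRingType) (G : sgraph) : 'M[F]_(graph_order G) :=
  diag_mx (\row_i (@degree G (enum_val i))%:R).

Definition signless_laplacian (F : nzRingType) (G : sgraph) :
  'M[F]_(graph_order G) := degree_mx F G + adjacency_mx F G.

Definition charpoly_at (F : fieldType) (n : nat) (M : 'M[F]_n) (x : F) : F :=
  \det (x%:M - M).

(* Meaningful only when x%:M - M is invertible: [invmx] is the identity on
   singular matrices. *)
Definition coronal (F : fieldType) (n : nat) (M : 'M[F]_n) (x : F) : F :=
  ((const_mx 1 : 'rV[F]_n) *m invmx (x%:M - M) *m (const_mx 1 : 'cV[F]_n))
    ord0 ord0.

(* nu lists the eigenvalues of M with their algebraic multiplicities. *)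
Definition eigenvalue_list (F : fieldType) (n m : nat) (M : 'M[F]_n)
    (nu : 'I_m -> F) : Prop :=
  char_poly M = \prod_(i < m) ('X - (nu i)%:P).

(* The constant c and the indeterminate x in the field of rational functions. *)
Definition ratC (R : idomainType) (c : R) : {fraction {poly R}} :=
  FracField.tofrac c%:P.

Definition ratX (R : idomainType) : {fraction {poly R}} :=
  FracField.tofrac 'X.

(* Main.v *)
(** Ordering the vertices of the corona as those of [G1] followed by the copies
    of [G2], the matrix [x - Q] is the block matrix
    [[ (x - n2 (r1 + 1)) - Q1 , - K (x) 1^T ], [ - K (x) 1 , I (x) M ]]
    with [(x)] the Kronecker product, [K = I + A1] and [M = (x - (r1 + 1)) - Q2].
    Its determinant is [det M ^ n1] times that of the Schur complement
    [(x - n2 (r1 + 1)) - Q1 - (1^T M^-1 1) K^2].  As [G1] is regular,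
    [K = (1 - r1) + Q1], so the complement is a polynomial in [Q1], and its
    determinant is the product of the values of this polynomial at the
    eigenvalues of [Q1]. *)

Require Import Defs.
From HB Require Import structures.
From mathcomp Require Import all_boot all_order all_algebra.
From mathcomp Require Import perm.

Set Implicit Arguments.
Unset Strict Implicit.
Unset Printing Implicit Defensive.

Import GRing.Theory.
Local Open Scope ring_scope.

(** * Determinant of a polynomial in a matrix *)

Lemma det_horner_char_poly (R : comNzRingType) n (A : 'M[R]_n) x :
  \det (x%:M - A) = (char_poly A).[x].
Proof.
rewrite /char_poly -horner_evalE -det_map_mx; congr (\det _).
by apply/matrixP => i j; rewrite !mxE /= horner_evalE !hornerE hornerMn hornerX.
Qed.

Lemma char_poly_conj (F : fieldType) n (P A : 'M[F]_n) :
  P \in unitmx -> char_poly (P *m A *m invmx P) = char_poly A.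
Proof.
move=> Pu; have PP : map_mx polyC P *m map_mx polyC (invmx P) = 1%:M.
  by rewrite -map_mxM mulmxV // map_mx1.
rewrite /char_poly.
have -> : char_poly_mx (P *m A *m invmx P) =
    map_mx polyC P *m char_poly_mx A *m map_mx polyC (invmx P).
  rewrite /char_poly_mx mulmxBr mulmxBl !map_mxM; congr (_ - _).
  by rewrite scalar_mxC -mulmxA PP mulmx1.
by rewrite !det_mulmx mulrAC -det_mulmx PP det1 mul1r.
Qed.

(** An eigenvector completed to a basis makes the first row of the conjugate a multiple of the first
    unit vector. Eigenvectors are row vectors, hence the lower triangular shape. *)
Lemma eigenvalue_conj_lblock (F : fieldType) n (A : 'M[F]_(1 + n)) a :
  eigenvalue A a -> exists P C B,
    P \in unitmx /\ P *m A *m invmx P = block_mx a%:M 0 C B.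
Proof.
case/eigenvalueP=> v vA v_neq0; pose P := row_ebase v.
have Pu : P \in unitmx by exact: row_ebase_unit.
exists P, (dlsubmx (P *m A *m invmx P)), (drsubmx (P *m A *m invmx P)).
split=> //.
pose e : 'rV[F]_(1 + n) := row_mx 1%:M 0.
(* As [v] has rank 1, it is a nonzero multiple of the first row of [P]. *)
have defv : col_ebase v *m (e *m P) = v.
  rewrite mulmxA -[RHS]mulmx_ebase rank_rV v_neq0; congr (_ *m _ *m _).
  by rewrite (pid_mx_row _ n 1).
have eP : e *m P *m A = a *: (e *m P).
  apply: (can_inj (mulKmx (col_ebase_unit v))).
  by rewrite mulmxA defv vA -scalemxAr defv.
have up : usubmx (P *m A *m invmx P) = a *: e.
  rewrite -[LHS]mul1mx -[RHS](mulmxK Pu) -scalemxAl -eP -!mulmxA.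
  by rewrite -{2}(vsubmxK (P *m _)) mul_row_col mul0mx addr0.
rewrite -[LHS]submxK /ulsubmx /ursubmx up /e scale_row_mx.
by rewrite row_mxKl row_mxKr scaler0 scalemx1.
Qed.

Lemma char_poly_lblock (R : comNzRingType) m n (A : 'M[R]_m) C (B : 'M[R]_n) :
  char_poly (block_mx A 0 C B) = char_poly A * char_poly B.
Proof.
rewrite /char_poly /char_poly_mx map_block_mx map_mx0 scalar_mx_block.
by rewrite opp_block_mx oppr0 add_block_mx addr0 det_lblock.
Qed.

(** Diagonal blocks of lower triangular block matrices add and multiply independently. The corner
    stays existential, as it does not enter the determinant. *)
Lemma horner_mx_lblock (R : comNzRingType) n a C (B : 'M[R]_n.+1) p :
  exists C', horner_mx (block_mx (a%:M : 'M_1) 0 C B : 'M_(1 + n.+1)) p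
    = block_mx (p.[a]%:M : 'M_1) 0 C' (horner_mx B p).
Proof.
elim/poly_ind: p => [|p c [C' IHp]].
  by exists 0; rewrite !rmorph0 horner0 raddf0 block_mx0.
exists (C' *m a%:M + horner_mx B p *m C).
rewrite !(rmorphD, rmorphM) /= !(horner_mx_X, horner_mx_C) IHp !hornerE.
transitivity (block_mx (p.[a]%:M : 'M_1) 0 C' (horner_mx B p)
              *m block_mx a%:M 0 C B + (c%:M : 'M_(1 + n.+1))); first by [].
rewrite mulmx_block scalar_mx_block.
by rewrite add_block_mx !(mulmx0, mul0mx, addr0, add0r) -!scalar_mxM raddfD.
Qed.

(* Induction on the eigenvalues: deflating one eigenvalue [a] makes [A] block
   triangular, and [horner_mx] acts on the diagonal blocks. *)
Lemma det_horner_mx (F : fieldType) n (A : 'M[F]_n.+1) (s : seq F) p :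
  char_poly A = \prod_(a <- s) ('X - a%:P) ->
  \det (horner_mx A p) = \prod_(a <- s) p.[a].
Proof.
elim: n A s => [|n IHn] A [|a s] charA;
  try by have := size_char_poly A; rewrite charA big_nil size_poly1.
  (* Order 1: comparing degrees leaves [a] as the only eigenvalue. *)
  have := size_char_poly A; rewrite charA size_prod_XsubC => -[/size0nil s0].
  move: charA; rewrite s0 !big_seq1 /char_poly [A]mx11_scalar => charA.
  have <- : A 0 0 = a.
    move: charA; rewrite det_mx11 !mxE /= !mulr1n.
    by move/addrI/oppr_inj/polyC_inj.
  have -> : forall c, horner_mx (c%:M : 'M_1) p = p.[c]%:M.
    move=> c; rewrite -diag_const_mx horner_mx_diag.
    by apply/matrixP => i j; rewrite !mxE.
  by rewrite det_scalar1.
have /eigenvalue_conj_lblock [P [C [B [Pu PA]]]] : eigenvalue A a.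
  by rewrite eigenvalue_root_char charA root_prod_XsubC mem_head.
have charB : char_poly B = \prod_(a <- s) ('X - a%:P).
  apply: (mulfI (monic_neq0 (monicXsubC a))).
  have := char_poly_lblock a%:M C B; rewrite -PA char_poly_conj // charA.
  rewrite big_cons => ->.
  by rewrite [in RHS]/char_poly det_mx11 !mxE /= !mulr1n.
have [C' hornerT] := horner_mx_lblock a C B p.
have : horner_mx (P *m A *m invmx P) p = P *m horner_mx A p *m invmx P.
  exact: horner_mx_uconj.
move/(congr1 determinant); rewrite !det_mulmx mulrAC -det_mulmx mulmxV // det1.
rewrite mul1r => <-; rewrite PA hornerT big_cons -(IHn _ _ charB).
rewrite -[p.[a] in RHS]det_scalar1.
exact: (det_lblock p.[a]%:M C' (horner_mx B p)).
Qed.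

(** * Determinants of block matrices and change of enumeration *)

Lemma det_castmx (R : comNzRingType) m n (e : m = n) (A : 'M[R]_m) :
  \det (castmx (e, e) A) = \det A.
Proof. by case: n / e. Qed.

Lemma det_mxdiag (R : comNzRingType) n (p_ : 'I_n -> nat)
    (B_ : forall i, 'M[R]_(p_ i)) :
  \det (\mxdiag_i B_ i) = \prod_i \det (B_ i).
Proof.
elim: n p_ B_ => [|n IHn] p_ B_.
  (* The order is an empty sum, so the matrix is generalized before this order is rewritten to 0. *)
  rewrite [RHS]big_ord0; move: (\mxdiag_i B_ i); rewrite big_ord0 => A.
  exact: det_mx00.
by rewrite mxdiag_recl det_castmx det_lblock IHn big_ord_recl.
Qed.

Lemma det_block_schur (F : fieldType) m n (A : 'M[F]_m) B C (D : 'M[F]_n) :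
  D \in unitmx ->
  \det (block_mx A B C D) = \det D * \det (A - B *m invmx D *m C).
Proof.
move=> Du; have -> : block_mx A B C D =
    block_mx (A - B *m invmx D *m C) B 0 D
    *m block_mx 1%:M 0 (invmx D *m C) 1%:M.
  rewrite mulmx_block !(mulmx1, mulmx0, mul0mx, add0r).
  by rewrite mulKVmx // mulmxA subrK.
by rewrite det_mulmx det_ublock det_lblock !det1 !mulr1 mulrC.
Qed.

(** Two enumerations differ by one permutation, applied to both rows and columns, so its sign occurs
    twice and cancels. *)
Lemma det_reindex (R : comNzRingType) (T : finType) n (h : 'I_n -> T)
    (f : T -> T -> R) : bijective h ->
  \det (\matrix_(i < n, j < n) f (h i) (h j))
    = \det (\matrix_(i < #|T|, j < #|T|) f (enum_val i) (enum_val j)).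
Proof.
move=> bij_h; have := bij_eq_card bij_h; rewrite card_ord => def_n; subst n.
have inj_s : injective (enum_rank \o h).
  exact: inj_comp enum_rank_inj (bij_inj bij_h).
pose s := perm inj_s; set A := (X in _ = \det X).
have -> : \matrix_(i, j) f (h i) (h j) = row_perm s (col_perm s A).
  by apply/matrixP => i j; rewrite !mxE !permE /= !enum_rankK.
rewrite row_permE col_permE !det_mulmx !det_perm odd_permV mulrCA.
by rewrite -signr_addb addbb mulr1.
Qed.

(** * Vertex degrees in the corona *)

Lemma degree_sum (G : sgraph) (v : vertex G) :
  degree v = (\sum_w edge v w)%N.
Proof. by rewrite /degree cardsE -sum1_card big_mkcond. Qed.

Lemma closed_nbhd_card (G : sgraph) (u : vertex G) :
  (\sum_v ((u == v) || edge u v))%N = (degree u).+1.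
Proof.
rewrite degree_sum (bigD1 u) //= eqxx (bigD1 u (P := xpredT)) //= edge_irr.
by congr _.+1; apply: eq_bigr => v; rewrite eq_sym => /negPf ->.
Qed.

Lemma sum_corona (G1 G2 : sgraph) (f : corona_vertex G1 G2 -> nat) :
  (\sum_w f w = \sum_u f (inl u) + \sum_u \sum_a f (inr (u, a)))%N.
Proof.
by rewrite big_sumType /=; congr addn; rewrite pair_big; apply: eq_bigr => -[].
Qed.

(** Besides its neighbors in [G1], [u] sees the whole copy attached to each vertex of its closed
    neighborhood. *)
Lemma degree_corona_base (G1 G2 : sgraph) (u : vertex G1) :
  @degree (closed_nbhd_corona G1 G2) (inl u)
    = (degree u + graph_order G2 * (degree u).+1)%N.
Proof.
rewrite degree_sum sum_corona /= -degree_sum; congr addn.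
rewrite -closed_nbhd_card big_distrr; apply: eq_bigr => v _.
by rewrite sum_nat_const edge_sym.
Qed.

Lemma degree_corona_copy (G1 G2 : sgraph) (u : vertex G1) (a : vertex G2) :
  @degree (closed_nbhd_corona G1 G2) (inr (u, a))
    = ((degree u).+1 + degree a)%N.
Proof.
rewrite degree_sum sum_corona /= closed_nbhd_card; congr addn.
rewrite (bigD1 u) //= [X in (_ + X)%N]big1 ?addn0.
  by rewrite degree_sum; apply: eq_bigr => b _; rewrite eqxx.
by move=> v /negPf uv; rewrite big1 // => b _; rewrite eq_sym uv.
Qed.

(** * Block enumeration of the corona *)

Section CoronaEnumeration.
Variables G1 G2 : sgraph.
Local Notation N1 := (graph_order G1).
Local Notation N2 := (graph_order G2).

(** The copies are indexed by a constant sum rather than a product, to match the index types of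
    [\mxrow], [\mxcol] and [\mxdiag]. *)
Definition corona_enum (i : 'I_(N1 + \sum_(_ < N1) N2)) : corona_vertex G1 G2 :=
  match split i with
  | inl u => inl (enum_val u)
  | inr s => inr (enum_val (tagnat.sig1 s), enum_val (tagnat.sig2 s))
  end.

Lemma corona_enum_lshift u : corona_enum (lshift _ u) = inl (enum_val u).
Proof. by rewrite /corona_enum (unsplitK (inl u)). Qed.

Lemma corona_enum_rshift s : corona_enum (rshift _ s)
  = inr (enum_val (tagnat.sig1 s), enum_val (tagnat.sig2 s)).
Proof. by rewrite /corona_enum (unsplitK (inr s)). Qed.

Lemma corona_enum_bij : bijective corona_enum.
Proof.
apply: inj_card_bij.
  move=> i j; case: (split_ordP i) => u ->; case: (split_ordP j) => v ->;
    rewrite ?corona_enum_lshift ?corona_enum_rshift //.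
    by case=> /enum_val_inj ->.
  case=> /enum_val_inj e1 /enum_val_inj e2; congr (rshift _ _).
  (* The type of [tagnat.sig2 u] depends on [tagnat.sig1 u], so second components are generalized
     before first ones are identified. *)
  rewrite -(tagnat.sig2K u) -(tagnat.sig2K v).
  by move: (tagnat.sig2 u) (tagnat.sig2 v) e2; rewrite /= e1 => x y ->.
by rewrite card_sum card_prod card_ord big_const_ord iter_addn_0 mulnC.
Qed.

End CoronaEnumeration.

(** * The corona determinant in block form *)

Lemma signless_laplacian_regular (R : nzRingType) (G : sgraph) r :
  regular G r -> signless_laplacian R G = r%:R%:M + adjacency_mx R G.
Proof.
by move=> regG; congr (_ + _); apply/matrixP => i j; rewrite !mxE regG.
Qed.

Lemma mulmx_sum_col_row (R : comNzRingType) m n p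
    (A : 'M[R]_(m, n)) (B : 'M_(n, p)) :
  A *m B = \sum_k col k A *m row k B.
Proof.
apply/matrixP => i j; rewrite mxE summxE; apply: eq_bigr => k _.
by rewrite mxE big_ord1 !mxE.
Qed.

(** In the Schur complement, copy [w] contributes [col w K] times the scalar 1^T M^-1 1 times
    [row w K]; these outer products sum to a multiple of [K *m K]. *)
Lemma det_kron_schur (F : fieldType) n m (A K : 'M[F]_n) (M : 'M[F]_m) :
  M \in unitmx ->
  \det (block_mx A (- \mxrow_(w < n) (col w K *m (const_mx 1 : 'rV_m)))
          (- \mxcol_(w < n) ((const_mx 1 : 'cV_m) *m row w K))
          (\mxdiag_(_ < n) M))
  = \det M ^+ n
    * \det (A - ((const_mx 1 : 'rV_m) *m invmx M *m (const_mx 1 : 'cV_m)) 0 0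
                *: (K *m K)).
Proof.
move=> Mu; have Du : \mxdiag_(_ < n) M \in unitmx.
  by rewrite unitmxE det_mxdiag prodr_const unitrX // -unitmxE.
rewrite det_block_schur // det_mxdiag prodr_const card_ord.
congr (_ * \det (_ - _)).
(* Factoring out the block diagonal matrix lets its inverse cancel without being computed. *)
have -> : \mxcol_(w < n) (const_mx 1 *m row w K)
    = \mxdiag_(_ < n) M *m \mxcol_(w < n) (invmx M *m (const_mx 1 *m row w K)).
  by rewrite mul_mxdiag_mxcol; apply: eq_mxcol => w; rewrite mulKVmx.
rewrite mulNmx mulmxN mulNmx opprK mulmxA mulmxKV // mul_mxrow_mxcol.
rewrite (mulmx_sum_col_row K K) scaler_sumr; apply: eq_bigr => w _.
rewrite -[LHS]mulmxA (mulmxA (const_mx 1)) (mulmxA (const_mx 1 *m _)).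
by rewrite [X in X *m row w K]mx11_scalar mul_scalar_mx -scalemxAr.
Qed.

Lemma corona_charpoly (F : fieldType) (G1 G2 : sgraph) r (x : F) :
  regular G1 r ->
  (x - (r + 1)%:R)%:M - signless_laplacian F G2 \in unitmx ->
  charpoly_at (signless_laplacian F (closed_nbhd_corona G1 G2)) x
  = charpoly_at (signless_laplacian F G2) (x - (r + 1)%:R) ^+ graph_order G1
    * \det ((x - (graph_order G2 * (r + 1))%:R)%:M - signless_laplacian F G1
            - coronal (signless_laplacian F G2) (x - (r + 1)%:R)
              *: ((1 - r%:R)%:M + signless_laplacian F G1) ^+ 2).
Proof.
move=> regG Mu; rewrite /charpoly_at -[_ ^+ 2]/(_ *m _) -[RHS]det_kron_schur //.
(* The entries of x - Q as a function of vertices, so that [det_reindex] applies. *)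
pose f (s t : vertex (closed_nbhd_corona G1 G2)) : F :=
  (x - (degree s)%:R) *+ (s == t) - (edge s t)%:R.
transitivity (\det (\matrix_(i < graph_order (closed_nbhd_corona G1 G2),
                      j < graph_order (closed_nbhd_corona G1 G2))
                      f (enum_val i) (enum_val j))).
  congr (\det _); apply/matrixP => i j; rewrite !mxE /f (inj_eq enum_val_inj).
  by rewrite opprD addrA mulrnBl.
rewrite -(det_reindex _ (corona_enum_bij G1 G2)); congr (\det _).
rewrite (signless_laplacian_regular _ regG).
(* By regularity (1 - r) + Q1 is I + A1, the 0/1 matrix of closed neighborhoods. *)
rewrite addrA -raddfD subrK; set K := 1%:M + _.
have KE u v :
    K u v = ((enum_val u == enum_val v) || edge (enum_val u) (enum_val v))%:R.
  rewrite !mxE (inj_eq enum_val_inj).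
  by have [->|] := eqVneq u v; rewrite ?edge_irr ?addr0 ?add0r.
clearbody K.
apply/matrixP => i j; rewrite mxE.
case: (split_ordP i) => u ->; case: (split_ordP j) => v ->;
  rewrite ?block_mxEul ?block_mxEur ?block_mxEdl ?block_mxEdr
    ?corona_enum_lshift ?corona_enum_rshift /f /=.
- rewrite degree_corona_base regG !mxE addn1.
  rewrite (inj_eq inl_inj) (inj_eq enum_val_inj).
  by rewrite natrD opprD addrA addrAC mulrnBl opprD addrA.
- by rewrite sub0r !mxE big_ord1 !mxE mulr1 KE edge_sym.
- by rewrite sub0r !mxE big_ord1 !mxE mul1r KE.
rewrite degree_corona_copy regG !mxE.
rewrite (inj_eq inr_inj) xpair_eqE !(inj_eq enum_val_inj).
(* Distinct copies give a zero block; within one copy the [r + 1] extra neighbors shift [x]. *)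
case: eqVneq => _; rewrite ?mxE ?subrr //= conform_mx_id !mxE.
by rewrite addn1 natrD !(opprD, addrA) mulrnBl.
Qed.

(** * Passage to eigenvalues and rational functions *)

Lemma det_quadratic_mx (F : fieldType) n (Q : 'M[F]_n) (nu : 'I_n -> F) c k h :
  eigenvalue_list Q nu ->
  \det (c%:M - Q - h *: (k%:M + Q) ^+ 2)
    = \prod_i (c - nu i - h * (k + nu i) ^+ 2).
Proof.
(* Order 0 is treated apart, as [det_horner_mx] is stated for positive order. *)
case: n Q nu => [|n] Q nu eigQ; first by rewrite det_mx00 big_ord0.
pose p := c%:P - 'X - h *: (k%:P + 'X) ^+ 2.
have -> : c%:M - Q - h *: (k%:M + Q) ^+ 2 = horner_mx Q p.
  rewrite !rmorphB /= horner_mxZ rmorphXn rmorphD /=.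
  by rewrite !(horner_mx_C, horner_mx_X).
rewrite (@det_horner_mx _ _ _ (codom nu)); last first.
  by rewrite eigQ big_image.
by rewrite big_image; apply: eq_bigr => i _; rewrite !hornerE.
Qed.

Lemma charpoly_at_eigenvalues (F : fieldType) n m (Q : 'M[F]_n)
    (nu : 'I_m -> F) x :
  eigenvalue_list Q nu -> charpoly_at Q x = \prod_i (x - nu i).
Proof.
move=> eigQ; rewrite /charpoly_at det_horner_char_poly eigQ horner_prod.
by apply: eq_bigr => i _; rewrite hornerXsubC.
Qed.

(** The field is arbitrary so that [x] can be either an element of the base field or the
    indeterminate of its field of rational functions. *)
Lemma corona_charpoly_eigenvalues (F : fieldType) (G1 G2 : sgraph) r
    (nu1 : 'I_(graph_order G1) -> F) (nu2 : 'I_(graph_order G2) -> F) x :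
  regular G1 r ->
  eigenvalue_list (signless_laplacian F G1) nu1 ->
  eigenvalue_list (signless_laplacian F G2) nu2 ->
  (x - (r + 1)%:R)%:M - signless_laplacian F G2 \in unitmx ->
  charpoly_at (signless_laplacian F (closed_nbhd_corona G1 G2)) x
  = (\prod_i (x - (r + 1)%:R - nu2 i) ^+ graph_order G1)
    * (\prod_i (x - (graph_order G2 * (r + 1))%:R - nu1 i
                - coronal (signless_laplacian F G2) (x - (r + 1)%:R)
                  * (1 - r%:R + nu1 i) ^+ 2)).
Proof.
move=> regG eig1 eig2 Mu; rewrite (corona_charpoly regG Mu).
rewrite (charpoly_at_eigenvalues _ eig2).
by rewrite (det_quadratic_mx _ _ _ eig1) prodrXl.
Qed.

Lemma map_signless_laplacian (R S : nzRingType) (f : {rmorphism R -> S}) G :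
  map_mx f (signless_laplacian R G) = signless_laplacian S G.
Proof.
by apply/matrixP => i j; rewrite !mxE rmorphD !rmorphMn !rmorph1.
Qed.

Lemma map_eigenvalue_list (F K : fieldType) (f : {rmorphism F -> K}) n m
    (Q : 'M[F]_n) (nu : 'I_m -> F) :
  eigenvalue_list Q nu -> eigenvalue_list (map_mx f Q) (f \o nu).
Proof.
rewrite /eigenvalue_list -map_char_poly => ->.
rewrite rmorph_prod; apply: eq_bigr => i _.
by rewrite rmorphB /= map_polyX map_polyC.
Qed.

Theorem theorem3 (R : rcfType) (G1 G2 : sgraph) (n1 n2 r1 : nat)
    (nu1 : 'I_n1 -> R) (nu2 : 'I_n2 -> R)
    (order1 : graph_order G1 = n1) (order2 : graph_order G2 = n2)
    (reg1 : regular G1 r1)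
    (eig1 : eigenvalue_list (signless_laplacian R G1) nu1)
    (eig2 : eigenvalue_list (signless_laplacian R G2) nu2) :
  (* as an identity of rational functions in the indeterminate x *)
  charpoly_at (signless_laplacian {fraction {poly R}}
                 (closed_nbhd_corona G1 G2)) (ratX R)
    = (\prod_(i < n2) (ratX R - (r1 + 1)%:R - ratC (nu2 i)) ^+ n1)
      * (\prod_(i < n1)
           (ratX R - (n2 * (r1 + 1))%:R - ratC (nu1 i)
            - coronal (signless_laplacian {fraction {poly R}} G2)
                (ratX R - (r1 + 1)%:R)
              * (1 - r1%:R + ratC (nu1 i)) ^+ 2))
  /\
  (* as an equality of values at every x where the coronal is defined *)
  (forall x : R,
     (x - (r1 + 1)%:R)%:M - signless_laplacian R G2 \in unitmx ->
     charpoly_at (signless_laplacian R (closed_nbhd_corona G1 G2)) x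
       = (\prod_(i < n2) (x - (r1 + 1)%:R - nu2 i) ^+ n1)
         * (\prod_(i < n1)
              (x - (n2 * (r1 + 1))%:R - nu1 i
               - coronal (signless_laplacian R G2) (x - (r1 + 1)%:R)
                 * (1 - r1%:R + nu1 i) ^+ 2))).
Proof.
subst n1 n2; split=> [|x]; last exact: corona_charpoly_eigenvalues.
pose f : {rmorphism R -> {fraction {poly R}}} := @FracField.tofrac _ \o polyC.
have eig1f := map_eigenvalue_list f eig1.
have eig2f := map_eigenvalue_list f eig2.
rewrite !map_signless_laplacian in eig1f eig2f.
apply: (corona_charpoly_eigenvalues reg1 eig1f eig2f).
(* At the indeterminate invertibility is automatic: the determinant is a product of nonzero
   polynomials of the form X - c. *)
rewrite unitmxE -[\det _]/(charpoly_at _ _) (charpoly_at_eigenvalues _ eig2f).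
rewrite unitfE; apply/prodf_neq0 => i _.
rewrite -(rmorph_nat f) -addrA -opprD -rmorphD -[ratX R - _]rmorphB.
by rewrite tofrac_eq0 polyXsubC_eq0.
Qed.
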